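(* The inverse map of $\alpha:\mathrm{Tree}\to\mathrm{End}$ is $\bar\alpha:\mathrm{End}\to\mathrm{Tree}$. That is, for every $n\ge 0$, $\alpha\circ\bar\alpha$ is the identity on $\mathrm{End}_n$ and $\bar\alpha\circ\alpha$ is the identity on $\mathrm{Tree}_n$.
   Context: Write $[n]=\{1,\dots,n\}$. $\mathrm{End}_n$ is the set of endofunctions $x:[n]\to[n]$, identified with words $x=x_1\dots x_n$, $x_i=x(i)$; $\mathrm{End}=\bigcup_{n\ge0}\mathrm{End}_n$. A binary tree is either empty or a triple $T=(L,r,R)$ with $r$ a node (the root) and $L,R$ binary trees (left and right subtree). $V(T)$ is the set of nodes and the size of $T$ is $|V(T)|$. A vertex labeling is a map $\mathfrak{l}:V(T)\to\{1,2,\dots\}$; $\max(T)$ is the largest label, with $\max(\emptyset)=0$. Labeled binary trees are considered up to label-preserving isomorphism of binary trees. $T$ is decreasing if it is empty, or $T=(L,r,R)$ with $L,R$ decreasing and $\mathfrak{l}(r)\ge\max\{\max(L),\max(R)\}$. $T$ is strictly decreasing to the left if it is empty, or $T=(L,r,R)$ with $\mathfrak{l}(r)>\max(L)$ and $L,R$ strictly decreasing to the left. An endotree of size $n$ is a decreasing binary tree of size $n$ that is strictly decreasing to the left and has all labels in $[n]$. $\mathrm{Tree}_n$ is the set of endotrees of size $n$ and $\mathrm{Tree}=\bigcup_{n\ge0}\mathrm{Tree}_n$. The in-order sequence $\alpha(T)$ of a labeled binary tree is the empty word if $T$ is empty, and $\alpha(T)=\alpha(L)\,\mathfrak{l}(r)\,\alpha(R)$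 (concatenation) if $T=(L,r,R)$; it maps $\mathrm{Tree}_n$ to $\mathrm{End}_n$. The max-decomposition of a nonempty word $x=x_1\dots x_n$ of positive integers is $x=\mathrm{pref}(x)\,x_m\,\mathrm{suff}(x)$, where $m$ is the index of the leftmost occurrence of $\max_i x_i$, $\mathrm{pref}(x)=x_1\dots x_{m-1}$ and $\mathrm{suff}(x)=x_{m+1}\dots x_n$. The tree $\bar\alpha(x)$ is empty if $x$ is empty; otherwise $\bar\alpha(x)=(L,r,R)$ with $\mathfrak{l}(r)=x_m$, $L=\bar\alpha(\mathrm{pref}(x))$, $R=\bar\alpha(\mathrm{suff}(x))$. *)

(* Defs.v *)
(* Mathematical Components *)
From mathcomp Require Import all_boot.

Set Implicit Arguments.
Unset Strict Implicit.
Unset Printing Implicit Defensive.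

(* [n] = {1, ..., n}. *)
Definition in_range (n i : nat) : bool := 1 <= i <= n.

(* End_n, as the set of words x_1 ... x_n with letters in [n];
   endofunctionsP and word_of_inj give the identification with maps. *)
Definition endofunctions (n : nat) : {pred seq nat} :=
  fun x => (size x == n) && all (in_range n) x.

(* Both the argument and the value i : 'I_n stand for i + 1 in [n]. *)
Definition word_of (n : nat) (f : {ffun 'I_n -> 'I_n}) : seq nat :=
  [seq (f i).+1 | i <- enum 'I_n].

Lemma endofunctionsP (n : nat) (x : seq nat) :
  reflect (exists f : {ffun 'I_n -> 'I_n}, x = word_of f)
          (x \in endofunctions n).
Proof.
apply: (iffP andP) => [[/eqP sx /allP hx]|[f ->]]; last first.
  split; first by rewrite size_map size_enum_ord.
  by apply/allP => _ /mapP [i _ ->]; rewrite /in_range /= ltn_ord.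
case: n sx hx => [|n] sx hx.
  exists [ffun i => i]; rewrite (size0nil sx); symmetry; apply: size0nil.
  by rewrite size_map size_enum_ord.
exists [ffun i : 'I_n.+1 => inord (nth 0 x i).-1].
apply: (@eq_from_nth _ 0); first by rewrite size_map size_enum_ord.
move=> i; rewrite sx => ltin.
rewrite (nth_map ord0) ?size_enum_ord // ffunE nth_enum_ord //.
have /hx /andP [h1 h2] : nth 0 x i \in x by rewrite mem_nth ?sx.
by rewrite inordK prednK.
Qed.

Lemma word_of_inj (n : nat) : injective (@word_of n).
Proof.
move=> f g /eq_in_map efg; apply/ffunP => i; apply: val_inj.
by have [] := efg i (mem_enum _ i).
Qed.

(* The inductive type has one element per isomorphism class of labeled
   binary trees; positivity of the labels is enforced in endotrees. *)
Inductive tree : Type :=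
| Empty
| Node of tree & nat & tree.

Fixpoint tree_size (T : tree) : nat :=
  if T is Node L _ R then (tree_size L + tree_size R).+1 else 0.

Fixpoint tree_max (T : tree) : nat :=
  if T is Node L r R then maxn r (maxn (tree_max L) (tree_max R)) else 0.

Fixpoint all_labels (p : pred nat) (T : tree) : bool :=
  if T is Node L r R then [&& p r, all_labels p L & all_labels p R] else true.

Fixpoint decreasing (T : tree) : bool :=
  if T is Node L r R then
    [&& decreasing L, decreasing R & maxn (tree_max L) (tree_max R) <= r]
  else true.

Fixpoint left_strict (T : tree) : bool :=
  if T is Node L r R then
    [&& tree_max L < r, left_strict L & left_strict R]
  else true.

Definition endotrees (n : nat) : {pred tree} :=
  fun T => [&& tree_size T == n, decreasing T, left_strict T
             & all_labels (in_range n) T].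

Fixpoint alpha (T : tree) : seq nat :=
  if T is Node L r R then alpha L ++ r :: alpha R else [::].

(* 0-based index of the leftmost occurrence of the maximal letter. *)
Definition max_index (x : seq nat) : nat := index (\max_(i <- x) i) x.
Definition pref (x : seq nat) : seq nat := take (max_index x) x.
Definition suff (x : seq nat) : seq nat := drop (max_index x).+1 x.

(* The recursion is on the length of the word, bounded by k; the defining
   equations of alphabar are alphabar_nil and alphabarE below. *)
Fixpoint alphabar_rec (k : nat) (x : seq nat) : tree :=
  if k is k'.+1 then
    if x is [::] then Empty
    else Node (alphabar_rec k' (pref x)) (nth 0 x (max_index x))
              (alphabar_rec k' (suff x))
  else Empty.

Definition alphabar (x : seq nat) : tree := alphabar_rec (size x) x.

Lemma max_index_lt (x : seq nat) : x != [::] -> max_index x < size x.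
Proof.
move=> x0; rewrite index_mem; elim: x x0 => // a [|b x] IH _.
  by rewrite big_seq1 mem_head.
rewrite big_cons; case: leqP => _; last exact: mem_head.
by rewrite in_cons IH ?orbT.
Qed.

Lemma max_decomposition (x : seq nat) :
  x != [::] -> x = pref x ++ nth 0 x (max_index x) :: suff x.
Proof. by move=> /max_index_lt lt; rewrite -drop_nth // cat_take_drop. Qed.

Lemma size_pref (x : seq nat) : x != [::] -> size (pref x) < size x.
Proof. by move=> /max_index_lt lt; rewrite size_take lt. Qed.

Lemma size_suff (x : seq nat) : x != [::] -> size (suff x) < size x.
Proof.
by move=> /max_index_lt lt; rewrite size_drop ltn_subrL (leq_ltn_trans _ lt).
Qed.

Lemma alphabar_rec_stable (k : nat) (x : seq nat) :
  size x <= k -> alphabar_rec k x = alphabar x.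
Proof.
suff stab i j y : size y <= i -> size y <= j ->
    alphabar_rec i y = alphabar_rec j y by move=> ?; apply: stab.
elim: i j y => [|i IH] [|j] [|a y] // lyi lyj /=.
have lp := size_pref (isT : a :: y != [::]).
have ls := size_suff (isT : a :: y != [::]).
by congr Node; apply: IH; rewrite -ltnS;
  [exact: leq_trans lp lyi | exact: leq_trans lp lyj
  |exact: leq_trans ls lyi | exact: leq_trans ls lyj].
Qed.

Lemma alphabar_nil : alphabar [::] = Empty.
Proof. by []. Qed.

Lemma alphabarE (x : seq nat) : x != [::] ->
  alphabar x =
  Node (alphabar (pref x)) (nth 0 x (max_index x)) (alphabar (suff x)).
Proof.
case: x => // a x x0; rewrite {1}/alphabar /=.
by rewrite !alphabar_rec_stable // -ltnS ?size_pref ?size_suff.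
Qed.

(* Main.v *)
(* In an endotree the labels of the left subtree are smaller than the root label
   and those of the right subtree at most equal to it, so the root sits at the
   leftmost maximum of the in-order word: the max-decomposition of that word
   recovers the root and the in-order words of the two subtrees. *)

Require Import Defs.
From mathcomp Require Import all_boot.

Lemma size_alpha (T : tree) : size (alpha T) = tree_size T.
Proof. by elim: T => //= L IHL r R IHR; rewrite size_cat /= IHL IHR addnS. Qed.

Lemma all_alpha (p : pred nat) (T : tree) : all p (alpha T) = all_labels p T.
Proof. by elim: T => //= L IHL r R IHR; rewrite all_cat /= IHL IHR andbCA. Qed.

Lemma bigmax_alpha (T : tree) : \max_(i <- alpha T) i = tree_max T.
Proof.
elim: T => [|L IHL r R IHR] /=; first by rewrite big_nil.
by rewrite big_cat big_cons /= IHL IHR maxnCA.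
Qed.

Lemma mem_leq_bigmax (x : seq nat) (i : nat) : i \in x -> i <= \max_(j <- x) j.
Proof. by move=> xi; apply: (leq_bigmax_seq _ xi). Qed.

Lemma notin_gt_bigmax (l : seq nat) (r : nat) :
  \max_(i <- l) i < r -> r \notin l.
Proof.
by move=> ltlr; apply: contraL ltlr => rl; rewrite -leqNgt mem_leq_bigmax.
Qed.

Lemma max_index_cat (l s : seq nat) (r : nat) :
  \max_(i <- l) i < r -> \max_(i <- s) i <= r ->
  max_index (l ++ r :: s) = size l.
Proof.
move=> ltlr lesr; rewrite /max_index big_cat big_cons /=.
rewrite (maxn_idPl lesr) (maxn_idPr (ltnW ltlr)) index_cat.
(* The overall maximum is now [r]; the strict bound keeps it out of [l], so its first occurrence
   comes right after [l]. *)
by rewrite (negPf (notin_gt_bigmax _ _ ltlr)) /= eqxx addn0.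
Qed.

Lemma alphabar_cat (l s : seq nat) (r : nat) :
  \max_(i <- l) i < r -> \max_(i <- s) i <= r ->
  alphabar (l ++ r :: s) = Node (alphabar l) r (alphabar s).
Proof.
move=> ltlr lesr; rewrite alphabarE; last by case: l {ltlr}.
rewrite /pref /suff (max_index_cat _ _ _ ltlr lesr) take_size_cat //.
(* [suff] drops [(size l).+1] letters, which is exactly the block [rcons l r]. *)
by rewrite nth_cat ltnn subnn /= -cat_rcons drop_size_cat // size_rcons.
Qed.

Lemma alphaK (T : tree) :
  decreasing T -> left_strict T -> alphabar (alpha T) = T.
Proof.
elim: T => //= L IHL r R IHR /and3P [dL dR leLR] /and3P [ltL sL sR].
move: leLR; rewrite geq_max => /andP [_ leR].
by rewrite alphabar_cat ?bigmax_alpha // IHL ?IHR.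
Qed.

(** Induction along the recursion of [alphabar], justified because both factors are shorter than
    [x]. *)
Lemma max_decomposition_ind (P : seq nat -> Prop) :
  P [::] -> (forall x, x != [::] -> P (pref x) -> P (suff x) -> P x) ->
  forall x, P x.
Proof.
move=> P0 PS x; have [k] := ubnP (size x).
elim: k x => // k IH x; rewrite ltnS => lexk.
have [-> //|x0] := eqVneq x [::].
by apply: PS => //; apply: IH; apply: leq_trans lexk;
  [exact: size_pref | exact: size_suff].
Qed.

(** Reading the two subtrees in order gives back [pref x] and [suff x], and the max-decomposition
    glues them. This also lets size, labels and maximum of [alphabar x] be read off [x]. *)
Lemma alphabarK : cancel alphabar alpha.
Proof.
elim/max_decomposition_ind => // x x0 IHp IHs.
by rewrite alphabarE //= IHp IHs -max_decomposition.
Qed.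

Lemma nth_max_index (x : seq nat) :
  x != [::] -> nth 0 x (max_index x) = \max_(i <- x) i.
Proof. by move=> /max_index_lt; rewrite index_mem; apply: nth_index. Qed.

Lemma tree_max_alphabar (x : seq nat) : tree_max (alphabar x) = \max_(i <- x) i.
Proof. by rewrite -bigmax_alpha alphabarK. Qed.

Lemma bigmax_suff_le (x : seq nat) :
  \max_(i <- suff x) i <= \max_(i <- x) i.
Proof.
by apply/bigmax_leqP_seq => i /mem_drop xi _; apply: mem_leq_bigmax.
Qed.

(* Positivity is needed when [pref x] is empty, its maximum being then 0. *)
Lemma bigmax_pref_lt (x : seq nat) : x != [::] -> all (leq 1) x ->
  \max_(i <- pref x) i < \max_(i <- x) i.
Proof.
move=> x0 /allP pos; have mx := max_index_lt x0.
have maxx : \max_(i <- x) i \in x by rewrite -index_mem.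
(* Writing the positive maximum as a successor turns the strict bound into a weak one, which can be
   checked letter by letter. *)
rewrite -[X in _ < X]prednK ?pos // ltnS; apply/bigmax_leqP_seq => i ip _.
rewrite -ltnS prednK ?pos // ltn_neqAle (mem_leq_bigmax _ _ (mem_take ip)) //.
(* A letter of [pref x] equal to the maximum would occur before the first occurrence of the
   maximum. *)
rewrite andbT; apply: contraTneq ip => ->.
by rewrite in_take_leq ?ltnn // ltnW.
Qed.

Lemma decreasing_alphabar (x : seq nat) :
  all (leq 1) x -> decreasing (alphabar x).
Proof.
elim/max_decomposition_ind: x => // x x0 IHp IHs pos.
(* Positivity must be passed on to both factors before the induction hypotheses apply. *)
have /= := pos; rewrite {1}(max_decomposition x0) all_cat /=.
move=> /and3P [/IHp dp _ /IHs ds].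
rewrite alphabarE //= dp ds !tree_max_alphabar nth_max_index // geq_max.
by rewrite bigmax_suff_le ltnW ?bigmax_pref_lt.
Qed.

Lemma left_strict_alphabar (x : seq nat) :
  all (leq 1) x -> left_strict (alphabar x).
Proof.
elim/max_decomposition_ind: x => // x x0 IHp IHs pos.
have /= := pos; rewrite {1}(max_decomposition x0) all_cat /=.
move=> /and3P [/IHp sp _ /IHs ss].
by rewrite alphabarE //= sp ss tree_max_alphabar nth_max_index ?bigmax_pref_lt.
Qed.

Theorem proposition2p3 (n : nat) :
  [/\ {in endotrees n, forall T, alpha T \in endofunctions n},
      {in endofunctions n, forall x, alphabar x \in endotrees n},
      {in endofunctions n, cancel alphabar alpha}
    & {in endotrees n, cancel alpha alphabar}].
Proof.
split=> [T /and4P [sT _ _ lT] | x /andP [sx lx] | x _ | T /and4P [_ dT lT _]].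
- by apply/andP; rewrite size_alpha all_alpha.
- have pos : all (leq 1) x by apply: sub_all lx => i /andP [].
  (* Size and label range of the tree become those of its in-order word, which is [x]. *)
  apply/and4P; rewrite -size_alpha -all_alpha alphabarK.
  by rewrite decreasing_alphabar ?left_strict_alphabar.
- exact: alphabarK.
- exact: alphaK.
Qed.
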